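(* Let $k,n$ be integers with $2\le k\le n$, and write $M_r=\binom{r}{2}$ for integers $r\ge2$. For any angle distance $\delta$ on $\mathrm{Gr}(k,n)$, $$N_1^{\delta}(k,n)\le\begin{cases}\dbinom{M_{n+1}+1}{2}-M_{n+1} & \text{if } k=2,\\[2ex] \dbinom{M_{n+1}+k-1}{k}-M_n\dbinom{M_n-1}{k-3}-n\dbinom{M_n}{k-3} & \text{if } 3\le k\le n.\end{cases}$$
   Context: $\mathrm{Gr}(k,n)$ is the set of $k$-dimensional linear subspaces of $\mathbb{R}^n$. For $\mathbb{U},\mathbb{V}\in\mathrm{Gr}(k,n)$ with orthonormal-basis matrices $U,V\in\mathbb{R}^{n\times k}$, the principal angles are $\theta_i(\mathbb{U},\mathbb{V})=\arccos\sigma_i\in[0,\pi/2]$, $i=1,\dots,k$, where $\sigma_1\ge\dots\ge\sigma_k$ are the singular values of $U^{T}V$. An angle distance on $\mathrm{Gr}(k,n)$ is a function $\delta:\mathrm{Gr}(k,n)\times\mathrm{Gr}(k,n)\to\mathbb{R}_{\ge0}$ such that $\delta(\mathbb{U},\mathbb{V})\in\{\theta_1(\mathbb{U},\mathbb{V}),\dots,\theta_k(\mathbb{U},\mathbb{V})\}$ for all $\mathbb{U},\mathbb{V}$. A finite subset $S\subseteq\mathrm{Gr}(k,n)$ is a $1$-distance set (equiangular) with respect to $\delta$ if there is a nonzero value $\alpha\in(0,\pi/2]$ such that $\delta(\mathbb{U},\mathbb{V})=\alpha$ for all $\mathbb{U}\neq\mathbb{V}$ in $S$. $N_1^{\delta}(k,n)$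 is the maximum cardinality of such a set. *)

(* Defs.v *)
From mathcomp Require Import all_boot all_order all_algebra finmap.
From mathcomp Require Import reals trigo.
Set Implicit Arguments.
Unset Strict Implicit.
Unset Printing Implicit Defensive.
Import Order.TTheory GRing.Theory Num.Theory.
Local Open Scope ring_scope.

Definition Gr (R : realType) (k n : nat) : Type :=
  {U : {vspace 'cV[R]_n} | \dim U == k}.

Definition orthonormal_basis_mx (R : realType) (k n : nat)
    (W : Gr R k n) (B : 'M[R]_(n, k)) : Prop :=
  B^T *m B = 1%:M /\ <<[seq col j B | j : 'I_k]>>%VS = val W.

(* [s] lists the singular values of the square matrix [A] in nonincreasing
   order, with multiplicity; it is determined by [A]. *)
Definition singular_values (R : realType) (k : nat)
    (A : 'M[R]_k) (s : 'rV[R]_k) : Prop :=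
  [/\ forall i, 0 <= s ord0 i,
      forall i j : 'I_k, (i <= j)%N -> s ord0 j <= s ord0 i
    & exists P Q : 'M[R]_k,
        [/\ P^T *m P = 1%:M, Q^T *m Q = 1%:M & A = P *m diag_mx s *m Q^T]].

(* The angles do not depend on the orthonormal bases, so some choice of bases
   is the same as any choice. *)
Definition principal_angles (R : realType) (k n : nat)
    (U V : Gr R k n) (theta : 'I_k -> R) : Prop :=
  exists (BU BV : 'M[R]_(n, k)) (s : 'rV[R]_k),
    [/\ orthonormal_basis_mx U BU, orthonormal_basis_mx V BV,
        singular_values (BU^T *m BV) s
      & forall i, theta i = acos (s ord0 i)].

Definition angle_distance (R : realType) (k n : nat)
    (delta : Gr R k n -> Gr R k n -> R) : Prop :=
  forall U V, 0 <= delta U V /\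
    exists2 theta : 'I_k -> R,
      principal_angles U V theta & exists i, delta U V = theta i.

Definition equiangular (R : realType) (k n : nat)
    (delta : Gr R k n -> Gr R k n -> R) (S : {fset Gr R k n}) : Prop :=
  exists2 alpha : R, 0 < alpha <= pi / 2 &
    forall U V, U \in S -> V \in S -> U != V -> delta U V = alpha.

(* [N] is the maximum N_1^delta(k, n). *)
Definition is_N1 (R : realType) (k n : nat)
    (delta : Gr R k n -> Gr R k n -> R) (N : nat) : Prop :=
  (exists2 S : {fset Gr R k n}, equiangular delta S & #|` S| = N) /\
  (forall S : {fset Gr R k n}, equiangular delta S -> (#|` S| <= N)%N).

Definition M (r : nat) : nat := 'C(r, 2).

(* The subtractions between terms are in [int], hence not truncated. *)
Definition N1_bound (k n : nat) : int :=
  if k == 2%N then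
    'C(M n.+1 + 1, 2)%:Z - (M n.+1)%:Z
  else
    'C(M n.+1 + k - 1, k)%:Z - (M n * 'C(M n - 1, k - 3))%:Z
      - (n * 'C(M n, k - 3))%:Z.

(* Main.v *)
Require Import Defs.
From mathcomp Require Import all_boot all_order all_algebra finmap.
From mathcomp Require Import boolp reals trigo.
From mathcomp Require Import fingroup perm zify ring lra.
Set Implicit Arguments.
Unset Strict Implicit.
Unset Printing Implicit Defensive.
Import Order.TTheory GRing.Theory Num.Theory.
Local Open Scope ring_scope.

(** The proof is by linear independence. Fix an equiangular set with angle
  alpha, put c = cos(alpha)^2, and write P_V for the orthogonal projector onto
  V. The squared cosines of the principal angles between U and V are the
  eigenvalues of B^T P_V B, for B an orthonormal basis of U, so the function
  f_V(U) = det(B^T (P_V - c) B) vanishes at every other member U of the set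
  ([principal_angle_root]), while f_V(V) = (1 - c)^k is nonzero because
  0 < alpha <= pi / 2 ([selfangle_nonroot]).

  Applying the Cauchy-Binet formula twice ([det_congruence_minors]) shows that
  f_V(U) is a quadratic form, with coefficients depending on V only, in the
  'C(n, k) maximal minors of B, that is, in the Plucker coordinates of U. The
  quadratic forms in m variables span a space of dimension 'C(m + 1, 2), and
  the forms attached to the set are independent
  ([card_quadratic_separation]); hence an equiangular set has at most
  'C('C(n, k) + 1, 2) members ([card_equiangular]).

  This Plucker bound is then compared with the bound of the theorem. With
  a = 'C(n, 2), it is at most 'C(a + k - 1, k), the dimension of the degree k
  forms in a variables ([bin2_bin_le]). Passing from a to a + n = M_(n+1)
  variables adds at least n * 'C(a + k - 1, k - 1), by n applications of
  Pascal's rule ([bin_addn_ge]), and this covers the terms subtracted in the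
  bound ([bin2_bin_le_N1_bound]). *)

(** * The Cauchy-Binet formula *)

Definition ksubset (n k : nat) := {I : {set 'I_n} | #|I| == k}.

Lemma card_ksubset n k : #|{: ksubset n k}| = 'C(n, k).
Proof. by rewrite card_sig -cardsE card_draws card_ord. Qed.

Definition ksubset_elt n k (I : ksubset n k) (i : 'I_k) : 'I_n :=
  enum_val (cast_ord (esym (eqP (valP I))) i).

Lemma ksubset_elt_inj n k (I : ksubset n k) : injective (ksubset_elt I).
Proof. by move=> i j /enum_val_inj /cast_ord_inj. Qed.

Lemma imset_ksubset_elt n k (I : ksubset n k) : ksubset_elt I @: 'I_k = val I.
Proof.
apply/eqP; rewrite eqEcard card_imset; last exact: ksubset_elt_inj.
rewrite card_ord (eqP (valP I)) leqnn andbT.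
by apply/subsetP => _ /imsetP[i _ ->]; apply: enum_valP.
Qed.

(** Every injective f : 'I_k -> 'I_n is, in exactly one way, the increasing
  enumeration of its image composed with a permutation; [arrangement] is the
  resulting parametrization. *)
Definition arrangement n k (p : (ksubset n k * 'S_k)%type) : {ffun 'I_k -> 'I_n} :=
  [ffun i => ksubset_elt p.1 (p.2 i)].

Lemma imset_arrangement n k (p : (ksubset n k * 'S_k)%type) :
  arrangement p @: 'I_k = val p.1.
Proof.
rewrite -imset_ksubset_elt; apply/setP => x; apply/imsetP/imsetP => -[i _ ->].
  by exists (p.2 i); rewrite ?ffunE.
by exists (p.2^-1%g i); rewrite ?ffunE ?permKV.
Qed.

Lemma arrangement_inj n k : injective (@arrangement n k).
Proof.
move=> [I s] [J t] eq_f; have eqIJ : I = J.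
  by apply: val_inj; rewrite -(imset_arrangement (I, s)) eq_f imset_arrangement.
rewrite eqIJ in eq_f *; congr (_, _); apply/permP => i.
by apply: (@ksubset_elt_inj _ _ J); move/ffunP/(_ i): eq_f; rewrite !ffunE.
Qed.

Lemma mem_arrangement n k (f : {ffun 'I_k -> 'I_n}) :
  (f \in @arrangement n k @: setT) = injectiveb f.
Proof.
apply/imsetP/injectiveP => [[[I s] _ ->] i j | f_inj].
  by rewrite !ffunE => /ksubset_elt_inj/perm_inj.
have card_f : #|f @: 'I_k| == k by rewrite card_imset ?card_ord.
pose I : ksubset n k := Sub (f @: 'I_k) card_f.
have preim i : exists j, f i == ksubset_elt I j.
  have : f i \in val I by rewrite imset_f.
  by rewrite -imset_ksubset_elt => /imsetP[j _ ->]; exists j.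
pose g i := xchoose (preim i).
have fE i : f i = ksubset_elt I (g i) by apply/eqP/(xchooseP (preim i)).
have g_inj : injective g by move=> i j gij; apply: f_inj; rewrite !fE gij.
by exists (I, perm g_inj); rewrite // -ffunP => i; rewrite ffunE permE.
Qed.

(** Expanding the product multilinearly gives a sum over all choices of k rows
  of [B]. Choices with a repetition contribute zero, and the k! arrangements of
  a given set of rows have determinants that differ by the sign of a permutation;
  summing these signs rebuilds the determinant of the corresponding columns of
  [A]. *)
Lemma cauchy_binet (F : comNzRingType) k n (A : 'M[F]_(k, n)) (B : 'M[F]_(n, k)) :
  \det (A *m B) = \sum_(I : ksubset n k)
    \det (colsub (ksubset_elt I) A) * \det (rowsub (ksubset_elt I) B).
Proof.
pose T (f : {ffun 'I_k -> 'I_n}) := \prod_i A i (f i) * \det (rowsub f B).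
have -> : \det (A *m B) = \sum_f T f.
  transitivity (\sum_(f : {ffun 'I_k -> 'I_n}) \sum_(s : 'S_k)
      (-1) ^+ s * \prod_i (A i (f i) * B (f i) (s i))).
    rewrite exchange_big; apply: eq_bigr => s _; rewrite -big_distrr /=.
    rewrite -(bigA_distr_bigA (fun i j => A i j * B j (s i))) /=.
    by congr (_ * _); apply: eq_bigr => i _; rewrite mxE.
  apply: eq_bigr => f _; rewrite /T [in RHS]mulrC big_distrl /=.
  apply: eq_bigr => s _; rewrite big_split /= -mulrA; congr (_ * _).
  by rewrite mulrC; congr (_ * _); apply: eq_bigr => i _; rewrite mxE.
rewrite (bigID (fun f : {ffun 'I_k -> 'I_n} => injectiveb f)) /=.
rewrite [X in _ + X]big1 ?addr0; last first.
  move=> f /injectivePn[i1 [i2 ne12 ef12]].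
  by rewrite /T (determinant_alternate ne12) ?mulr0 // => j; rewrite !mxE ef12.
rewrite -(eq_bigl _ _ (@mem_arrangement n k)) big_imset /=; last first.
  by move=> p q _ _; apply: arrangement_inj.
rewrite (eq_bigl xpredT) => [|p]; last by rewrite inE.
rewrite -(pair_big xpredT xpredT (fun I s => T (arrangement (I, s)))) /=.
apply: eq_bigr => I _; rewrite big_distrl; apply: eq_bigr => s _; rewrite /T /=.
have -> : rowsub (arrangement (I, s)) B = row_perm s (rowsub (ksubset_elt I) B).
  by apply/matrixP => i j; rewrite !mxE ffunE.
rewrite row_permE det_mulmx det_perm mulrCA mulrA; congr (_ * _ * _).
by apply: eq_bigr => i _; rewrite !mxE ffunE.
Qed.

(** * Comparison of binomial coefficients *)

Lemma double_bin2S x : ('C(x.+1, 2) * 2 = x.+1 * x)%N.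
Proof. by rewrite mulnC -mul_bin_diag bin1. Qed.

(** Induction on [k], starting from an equality at k = 2. From k to k + 1, the
  number m = 'C(n, k) is multiplied by (n - k) / (k + 1) and the right-hand
  side by (a + k) / (k + 1), where a = 'C(n, 2). If the first factor is at most
  1 the left-hand side does not increase; otherwise 'C(m + 1, 2) grows at most
  by the square of that factor, and (n - k)^2 <= 2 * a <= (k + 1) * (a + k). *)
Lemma bin2_bin_le n k : (2 <= k <= n)%N ->
  ('C('C(n, k) + 1, 2) <= 'C('C(n, 2) + k - 1, k))%N.
Proof.
case/andP; elim: k => // k IHk; rewrite leq_eqVlt => /orP[/eqP[<-]|k2] kn.
  by rewrite !addn1 addn2 subn1.
have {IHk} := IHk k2 (ltnW kn).
set a := 'C(n, 2); set m := 'C(n, k); set m' := 'C(n, k.+1).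
rewrite !addn1 !subn1 addnS /=.
have mb : (k.+1 * m' = (n - k) * m)%N by apply: mul_bin_left.
have := mul_bin_diag (a + k) k.
set Y := 'C(_, k); set Y' := 'C(_, k.+1) => bd XY.
have a1 : (0 < a)%N by rewrite bin_gt0; lia.
have [r_le|r_gt] := leqP (n - k) k.+1.
  have m'm : (m' <= m)%N.
    by rewrite -(leq_pmul2l (ltn0Sn k)) mb leq_mul2r r_le orbT.
  have YY' : (Y <= Y')%N.
    by rewrite -(leq_pmul2l (ltn0Sn k)) -bd leq_mul2r -addn1 addnC leq_add2r a1 orbT.
  by apply: leq_trans YY'; apply: leq_trans XY; apply: leq_bin2l.
have r2 : ((n - k) ^ 2 <= k.+1 * (a + k))%N.
  apply: (@leq_trans (a * 2)); last by rewrite mulnC leq_mul ?leq_addr // ltnS ltnW.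
  have := double_bin2S n.-1; rewrite prednK -/a; last by lia.
  by move=> ->; rewrite leq_mul; lia.
rewrite -(leq_pmul2r (isT : 0 < 2)%N) double_bin2S.
have := leq_mul XY (leqnn 2); rewrite double_bin2S => XY2.
rewrite -(leq_pmul2l (ltn0Sn k)) -(leq_pmul2l (ltn0Sn k)).
have -> : (k.+1 * (k.+1 * (m'.+1 * m')) = (k.+1 * m' + k.+1) * (k.+1 * m'))%N by lia.
have -> : (k.+1 * (k.+1 * (Y' * 2)) = k.+1 * (a + k) * (Y * 2))%N.
  by rewrite (mulnA k.+1 Y') -bd !mulnA.
rewrite mb; apply: leq_trans (leq_mul r2 XY2).
have -> : ((n - k) ^ 2 * (m.+1 * m) = ((n - k) * m + (n - k)) * ((n - k) * m))%N by lia.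
by rewrite leq_mul2r leq_add2l (ltnW r_gt) orbT.
Qed.

Lemma bin_addn_ge p q k : ('C(p, k.+1) + q * 'C(p, k) <= 'C(p + q, k.+1))%N.
Proof.
elim: q => [|q IHq]; first by rewrite mul0n !addn0.
rewrite mulSn addnCA addnC addnS binS leq_add // leq_bin2l //.
exact: leq_addr.
Qed.

(** For k >= 3 the first subtracted term equals (k - 2) * 'C(a, k - 2) with
  a = 'C(n, 2). As k - 2 <= n, the two subtracted terms add up to at most
  n * ('C(a, k - 2) + 'C(a, k - 3)) = n * 'C(a + 1, k - 2), which is at most
  the gain of [bin_addn_ge]. For k = 2 the bound is exactly 'C(a + n, 2). *)
Lemma bin2_bin_le_N1_bound k n : (2 <= k <= n)%N ->
  'C('C(n, k) + 1, 2)%:Z <= N1_bound k n.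
Proof.
move=> kn; have /andP[k2 k_le_n] := kn.
have ME : M n.+1 = ('C(n, 2) + n)%N by rewrite /M binS bin1.
rewrite /N1_bound; case: eqP => [k2E | /eqP k_neq2].
  rewrite (addn1 (M _)) [X in _ <= Posz X - _]binS bin1 PoszD addrK lez_nat k2E ME.
  by apply: leq_bin2l; rewrite leq_add2l; lia.
case: k => [|[|[|k]]] // in kn k2 k_le_n k_neq2 *.
have := bin2_bin_le kn; have := bin_addn_ge ('C(n, 2) + k.+2) n k.+2.
rewrite ME -!addnBA // !subn1 /= !subSS subn0 /M.
set a := 'C(n, 2).
rewrite -[(a + n + _)%N]addnAC.
have mid : ('C(a, k.+1) + 'C(a, k) <= 'C(a + k.+2, k.+2))%N.
  rewrite -binS addnS [leqRHS]binS; apply: leq_trans (leq_addl _ _).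
  by apply: leq_bin2l; lia.
have := leq_mul (leqnn n) mid.
have : (k.+1 * 'C(a, k.+1) <= n * 'C(a, k.+1))%N by rewrite leq_mul2r; lia.
rewrite mul_bin_diag mulnDr; lia.
Qed.

(** * Independence of quadratic forms *)

Definition pair_sort (J : finType) (p : J * J) : J * J :=
  if (enum_rank p.1 <= enum_rank p.2)%N then p else (p.2, p.1).

Lemma card_sorted_pairs (J : finType) :
  #|[set p : J * J | (enum_rank p.1 <= enum_rank p.2)%N]| = 'C(#|J|.+1, 2).
Proof.
rewrite -bin2_sum big_nat_recl //= add0n big_mkord cardsE -sum1_card.
under eq_bigl do rewrite unfold_in.
rewrite -(pair_big_dep xpredT (fun i j : J => (enum_rank i <= enum_rank j)%N)
  (fun _ _ => 1%N)) /=.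
rewrite (exchange_big_dep xpredT) //=.
rewrite (reindex _ (onW_bij _ (enum_val_bij J))) /=; apply: eq_bigr => j _.
rewrite (reindex _ (onW_bij _ (enum_val_bij J))) /=.
under eq_bigl do rewrite !enum_valK.
rewrite -(big_ord_widen #|J| (fun _ => 1%N) (ltn_ord j)).
by rewrite sum1_card card_ord.
Qed.

(** A dimension count: grouping the coefficients of (i, j) and (j, i), the
  matrix of the values of the forms at the points factors through the space
  indexed by sorted pairs, and it is diagonal with nonzero entries, hence of
  rank #|T|. *)
Lemma card_quadratic_separation (F : fieldType) (T J : finType)
    (x : T -> J -> F) (Q : T -> J -> J -> F) :
  (forall a, \sum_i \sum_j Q a i j * (x a i * x a j) != 0) ->
  (forall a b, a != b -> \sum_i \sum_j Q a i j * (x b i * x b j) = 0) ->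
  (#|T| <= 'C(#|J|.+1, 2))%N.
Proof.
move=> q_diag q_off; pose q a b := \sum_i \sum_j Q a i j * (x b i * x b j).
rewrite -card_sorted_pairs; set D := [set _ | _].
pose G := \matrix_(a < #|T|, d < #|D|)
  \sum_(p : J * J | pair_sort p == enum_val d) Q (enum_val a) p.1 p.2.
pose H := \matrix_(d < #|D|, b < #|T|)
  (x (enum_val b) (enum_val d).1 * x (enum_val b) (enum_val d).2).
have GH : G *m H = diag_mx (\row_a q (enum_val a) (enum_val a)).
  apply/matrixP => a b; rewrite !mxE.
  have -> : \sum_d G a d * H d b = q (enum_val a) (enum_val b).
    rewrite /q pair_big /=.
    rewrite (partition_big (@pair_sort J) (mem D)) /=; last first.
      by move=> p _; rewrite inE /pair_sort; case: (leqP (enum_rank p.1)) => [|/ltnW].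
    rewrite [RHS]big_enum_val; apply: eq_bigr => d _; rewrite !mxE big_distrl.
    apply: eq_bigr => p /eqP <-; rewrite /pair_sort.
    by case: ifP => //= _; rewrite [X in _ * X]mulrC.
  have [<-|ne_ab] := eqVneq a b; rewrite ?mulr1n ?mulr0n //.
  by apply: q_off; rewrite (inj_eq enum_val_inj).
have := mulmx_max_rank G H; rewrite GH mxrank_unit // unitmxE det_diag unitfE.
by apply/prodf_neq0 => a _; rewrite mxE; apply: q_diag.
Qed.

(** * Principal angles as roots of a quadratic form in Plucker coordinates *)

Lemma det_congruence_minors (F : comNzRingType) k n
    (A : 'M[F]_n) (B : 'M[F]_(n, k)) :
  \det (B^T *m A *m B) = \sum_(I : ksubset n k) \sum_(J : ksubset n k)
    \det (mxsub (ksubset_elt J) (ksubset_elt I) A) *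
    (\det (rowsub (ksubset_elt I) B) * \det (rowsub (ksubset_elt J) B)).
Proof.
rewrite cauchy_binet; apply: eq_bigr => I _.
have -> : colsub (ksubset_elt I) (B^T *m A) = B^T *m colsub (ksubset_elt I) A.
  by rewrite mulmx_colsub.
rewrite cauchy_binet big_distrl; apply: eq_bigr => J _.
have -> : colsub (ksubset_elt J) B^T = (rowsub (ksubset_elt J) B)^T.
  by apply/matrixP => i j; rewrite !mxE.
have -> : rowsub (ksubset_elt J) (colsub (ksubset_elt I) A) =
    mxsub (ksubset_elt J) (ksubset_elt I) A.
  by apply/matrixP => i j; rewrite !mxE.
by rewrite det_tr /=; ring.
Qed.

Lemma projector_fixes_span (R : realType) k n (W : Gr R k n) (B : 'M[R]_(n, k))
    (v : 'cV[R]_n) :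
    orthonormal_basis_mx W B -> v \in val W ->
  B *m B^T *m v = v.
Proof.
case=> BB <-; pose f : 'End('cV[R]_n) := linfun (mulmx (B *m B^T)).
have /subvP/(_ v) sub : (<<[seq col j B | j : 'I_k]>> <= fixedSpace f)%VS.
  apply/span_subvP => _ /mapP[j _ ->]; apply/fixedSpaceP.
  by rewrite lfunE /= !colE !mulmxA -(mulmxA B B^T) BB mulmx1.
by move=> /sub/fixedSpaceP; rewrite lfunE.
Qed.

(** The angles between two subspaces may be witnessed by other bases than the
  ones fixed for the determinant argument; this lemma and the next one reduce
  either choice to the other. *)
Lemma orthonormal_basis_change (R : realType) k n (W : Gr R k n)
    (B B' : 'M[R]_(n, k)) :
    orthonormal_basis_mx W B -> orthonormal_basis_mx W B' ->
  exists2 X : 'M[R]_k, X^T *m X = 1%:M & B' = B *m X.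
Proof.
move=> oB [BB' spanB'].
have proj : B *m B^T *m B' = B'.
  apply/matrixP => i j.
  have /(projector_fixes_span oB) : col j B' \in val W.
    by rewrite -spanB'; apply/memv_span/image_f.
  by rewrite colE mulmxA -!colE => /matrixP/(_ i 0); rewrite !mxE.
exists (B^T *m B'); last by rewrite mulmxA.
by rewrite trmx_mul trmxK -mulmxA (mulmxA B) proj.
Qed.

Lemma orthonormal_projector (R : realType) k n (W : Gr R k n)
    (B B' : 'M[R]_(n, k)) :
    orthonormal_basis_mx W B -> orthonormal_basis_mx W B' ->
  B' *m B'^T = B *m B^T.
Proof.
move=> oB oB'; have [X XX ->] := orthonormal_basis_change oB oB'.
by rewrite trmx_mul mulmxA -(mulmxA B) (mulmx1C XX) mulmx1.
Qed.

(** If u is the unit vector of U attached to s_i, then s_i is the length of the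
  orthogonal projection of u on V, and u minus that projection has squared
  length 1 - s_i^2. This makes the cosine of acos s_i equal to s_i. All k
  vectors u are treated at once, as the columns of a matrix. *)
Lemma singular_values_le1 (R : realType) k n (U V : Gr R k n)
    (BU BV : 'M[R]_(n, k)) (s : 'rV[R]_k) i :
    orthonormal_basis_mx U BU -> orthonormal_basis_mx V BV ->
    singular_values (BU^T *m BV) s ->
  s 0 i <= 1.
Proof.
case=> oU _ [oV _] [s_ge0 _ [P [Q [PP QQ svd]]]].
pose u := BU *m P; pose z := BV^T *m u; pose w := u - BV *m z.
have uu : u^T *m u = 1%:M by rewrite trmx_mul mulmxA -(mulmxA P^T) oU mulmx1.
have zE : z = Q *m diag_mx s.
  rewrite /z /u mulmxA -[BV^T *m BU]trmxK trmx_mul trmxK svd.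
  by rewrite !trmx_mul trmxK tr_diag_mx -!mulmxA PP mulmx1.
have zz : z^T *m z = diag_mx s *m diag_mx s.
  by rewrite zE trmx_mul tr_diag_mx mulmxA -(mulmxA _ Q^T) QQ mulmx1.
have ww : w^T *m w = 1%:M - diag_mx s *m diag_mx s.
  have utV : u^T *m BV = z^T by rewrite /z (trmx_mul BV^T) trmxK.
  have wT : w^T = u^T - z^T *m BV^T by rewrite /w [LHS]linearB /= (trmx_mul BV).
  rewrite wT mulmxBl !mulmxBr uu mulmxA utV.
  rewrite -(mulmxA _ _ u) -/z -(mulmxA _ BV^T) (mulmxA BV^T) oV mul1mx zz.
  by rewrite subrr subr0.
have : 0 <= (w^T *m w) i i.
  by rewrite mxE sumr_ge0 // => j _; rewrite !mxE sqr_ge0.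
rewrite ww mulmx_diag !mxE eqxx !mulr1n subr_ge0 -expr2 => s2_le1.
by rewrite -(ler_sqr (s_ge0 i)) ?nnegrE // expr1n.
Qed.

(** In the bases given by the singular value decomposition, B^T P_V B becomes
  the diagonal matrix of the s_i^2, where s_i = cos(theta_i). *)
Lemma principal_angle_root (R : realType) k n (U V : Gr R k n)
    (BU BV : 'M[R]_(n, k)) (theta : 'I_k -> R) i :
    orthonormal_basis_mx U BU -> orthonormal_basis_mx V BV ->
    principal_angles U V theta ->
  \det (BU^T *m (BV *m BV^T - (cos (theta i) ^+ 2)%:M) *m BU) = 0.
Proof.
move=> oU oV [B1 [B2 [s [o1 o2 sv ->]]]].
have s_le1 := singular_values_le1 i o1 o2 sv.
have [s_ge0 _ [P [Q [PP QQ svd]]]] := sv.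
rewrite acosK; last by rewrite in_itv /= s_le1 andbT (le_trans _ (s_ge0 i)) ?lerN10.
set c := _ ^+ 2.
have [X XX ->] := orthonormal_basis_change o1 oU.
rewrite (orthonormal_projector o2 oV).
have -> : (B1 *m X)^T *m (B2 *m B2^T - c%:M) *m (B1 *m X) =
    X^T *m (P *m (diag_mx s *m diag_mx s - c%:M) *m P^T) *m X.
  rewrite trmx_mul -!mulmxA; congr (_ *m _); rewrite !mulmxA; congr (_ *m _).
  rewrite !mulmxBr !mulmxBl !mul_mx_scalar -!scalemxAl (proj1 o1).
  rewrite (mulmx1C PP); congr (_ - _).
  have -> : B1^T *m (B2 *m B2^T) *m B1 = (B1^T *m B2) *m (B1^T *m B2)^T.
    by rewrite trmx_mul trmxK !mulmxA.
  rewrite svd !trmx_mul trmxK tr_diag_mx !mulmxA -(mulmxA _ Q^T Q) QQ.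
  by rewrite mulmx1.
rewrite !det_mulmx mulmx_diag -diag_const_mx -linearB det_diag (bigD1 i) //=.
by rewrite !mxE /c expr2 subrr !(mul0r, mulr0).
Qed.

Lemma selfangle_nonroot (R : realType) k n (W : Gr R k n)
    (B : 'M[R]_(n, k)) (c : R) :
    orthonormal_basis_mx W B -> c != 1 ->
  \det (B^T *m (B *m B^T - c%:M) *m B) != 0.
Proof.
case=> BB _ c1; rewrite mulmxBr mulmxBl mulmxA BB mul1mx BB mul_mx_scalar.
rewrite -scalemxAl BB scalemx1 -raddfB /= det_scalar expf_neq0 //.
by rewrite subr_eq0 eq_sym.
Qed.

Lemma card_equiangular (R : realType) k n
    (delta : Gr R k n -> Gr R k n -> R) (S : {fset Gr R k n}) :
    angle_distance delta -> equiangular delta S ->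
  (#|` S| <= 'C('C(n, k) + 1, 2))%N.
Proof.
move=> hdelta [alpha /andP[alpha_gt0 alpha_le] eqS].
(* a distance value at (W, W) comes with a basis of W, so bases exist *)
have /choice[basis basisP] (W : Gr R k n) : exists B, orthonormal_basis_mx W B.
  by have [_ [_ [B [_ [_ [oB _ _ _]]]] _]] := hdelta W W; exists B.
pose c := cos alpha ^+ 2.
have c_neq1 : c != 1.
  have alpha_in : 0 < alpha < pi by rewrite alpha_gt0; have := pi_gt0 R; lra.
  by rewrite -subr_eq0 -oppr_eq0 opprB -sin2cos2 sqrf_eq0 lt0r_neq0 ?sin_gt0_pi.
pose A (V : Gr R k n) := basis V *m (basis V)^T - c%:M.
rewrite addn1 -(card_ksubset n k) cardfE.
apply: (@card_quadratic_separation R S (ksubset n k)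
  (fun (U : S) I => \det (rowsub (ksubset_elt I) (basis (fsval U))))
  (fun (V : S) I J => \det (mxsub (ksubset_elt J) (ksubset_elt I) (A (fsval V))))).
  by move=> U; rewrite -det_congruence_minors; apply: selfangle_nonroot.
move=> V U neVU; rewrite -det_congruence_minors.
have [_ [theta angles [i deltaE]]] := hdelta (fsval U) (fsval V).
have cE : c = cos (theta i) ^+ 2.
  by rewrite -deltaE eqS ?fsvalP // (inj_eq val_inj) eq_sym.
by rewrite /A cE; apply: principal_angle_root.
Qed.

Theorem theorem5p2 (R : realType) (k n : nat) (hk : (2 <= k <= n)%N)
    (delta : Gr R k n -> Gr R k n -> R) (hdelta : angle_distance delta) :
  exists2 N : nat, is_N1 delta N & N%:Z <= N1_bound k n.
Proof.
pose attained N := `[< exists2 S, equiangular delta S & #|` S| = N >].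
have ex_attained : exists N, attained N.
  exists 0%N; apply/asboolP; exists fset0; last exact: cardfs0.
  by exists (pi / 2) => //; rewrite lexx divr_gt0 ?pi_gt0.
have attained_le N : attained N -> (N <= 'C('C(n, k) + 1, 2))%N.
  by move=> /asboolP[S eqS <-]; apply: card_equiangular hdelta eqS.
case: (ex_maxnP ex_attained attained_le) => N N_attained N_max.
exists N; last first.
  by apply: le_trans (bin2_bin_le_N1_bound hk); rewrite lez_nat attained_le.
split; first exact/asboolP.
by move=> S eqS; apply: N_max; apply/asboolP; exists S.
Qed.
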